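(* Let $x,x'\in\mathbb R$ and let $z,z'$ be complex numbers in the open upper half plane. With $\widetilde K_{2M}$ the $2\times 2$ matrix kernel defined in the context, the (entrywise, pointwise) limit $K=\lim_{M\to\infty}\widetilde K_{2M}$ exists, and: (1) $$K(x,x')=\begin{bmatrix}\frac1{\sqrt{2\pi}}(x'-x)e^{-\frac12(x-x')^2}&\frac1{\sqrt{2\pi}}e^{-\frac12(x-x')^2}\\-\frac1{\sqrt{2\pi}}e^{-\frac12(x-x')^2}&\frac12\operatorname{sgn}(x-x')\operatorname{erfc}\!\left(\frac{|x-x'|}{\sqrt2}\right)\end{bmatrix}.$$ (2) $$K(z,z')=\frac1{\sqrt{2\pi}}\sqrt{\operatorname{erfc}(\sqrt2\operatorname{Im}z)\operatorname{erfc}(\sqrt2\operatorname{Im}z')}\begin{bmatrix}(z'-z)e^{-\frac12(z-z')^2}&i(\overline z'-z)e^{-\frac12(z-\overline z')^2}\\i(z'-\overline z)e^{-\frac12(\overline z-z')^2}&-(\overline z'-\overline z)e^{-\frac12(\overline z-\overline z')^2}\end{bmatrix}.$$ (3) $$K(x,z)=\frac1{\sqrt{2\pi}}\sqrt{\operatorname{erfc}(\sqrt2\operatorname{Im}z)}\begin{bmatrix}(z-x)e^{-\frac12(x-z)^2}&i(\overline z-x)e^{-\frac12(x-\overline z)^2}\\-e^{-\frac12(x-z)^2}&-ie^{-\frac12(x-\overline z)^2}\end{bmatrix}.$$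
   Context: $\gamma(a,x)=\int_0^xt^{a-1}e^{-t}dt$; $\operatorname{sgn}0=0$; $c_M(\gamma)=\sum_{k=0}^{M-1}\frac{\gamma^{2k}}{(2k)!}$, $e_M(\gamma)=\sum_{k=0}^{2M-2}\frac{\gamma^k}{k!}$; $\mathcal E(\gamma,\gamma')=\frac12\operatorname{sgn}(\gamma-\gamma')$ if $\gamma,\gamma'\in\mathbb R$, and $0$ otherwise; $\overline z'$ is the conjugate of $z'$. For $z\in\mathbb C,x\in\mathbb R$, $$r_M(z,x)=\frac{e^{-z^2/2}}{\sqrt{2\pi}}\sqrt{\operatorname{erfc}(\sqrt2|\operatorname{Im}z|)}\frac{2^{M-3/2}}{(2M-2)!}\operatorname{sgn}(x)z^{2M-1}\gamma\!\left(M-\tfrac12,\tfrac{x^2}2\right).$$ The kernel (for the real Ginibre ensemble of $2M\times2M$ matrices) is $$\widetilde K_{2M}(\gamma,\gamma')=\begin{bmatrix}\widetilde{DS}_{2M}(\gamma,\gamma')&\widetilde S_{2M}(\gamma,\gamma')\\-\widetilde S_{2M}(\gamma',\gamma)&\widetilde{IS}_{2M}(\gamma,\gamma')+\mathcal E(\gamma,\gamma')\end{bmatrix},$$ where, for $x,x'\in\mathbb R$ and $z,z'$ in the open upper half plane: Real/real: $\widetilde S_{2M}(x,x')=\frac{e^{-\frac12(x-x')^2}}{\sqrt{2\pi}}e^{-xx'}e_M(xx')+r_M(x,x')$; $\widetilde{DS}_{2M}(x,x')=\frac{e^{-\frac12(x-x')^2}}{\sqrt{2\pi}}(x'-x)e^{-xx'}e_M(xx')$;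 $\widetilde{IS}_{2M}(x,x')=\frac{e^{-x^2/2}}{2\sqrt\pi}\operatorname{sgn}(x')\int_0^{x'^2/2}\frac{e^{-t}}{\sqrt t}c_M(x\sqrt{2t})dt-\frac{e^{-x'^2/2}}{2\sqrt\pi}\operatorname{sgn}(x)\int_0^{x^2/2}\frac{e^{-t}}{\sqrt t}c_M(x'\sqrt{2t})dt$. Complex/complex, with $E=\sqrt{\operatorname{erfc}(\sqrt2\operatorname{Im}z)\operatorname{erfc}(\sqrt2\operatorname{Im}z')}$: $\widetilde S_{2M}(z,z')=\frac{ie^{-\frac12(z-\overline z')^2}}{\sqrt{2\pi}}(\overline z'-z)Ee^{-z\overline z'}e_M(z\overline z')$; $\widetilde{DS}_{2M}(z,z')=\frac{e^{-\frac12(z-z')^2}}{\sqrt{2\pi}}(z'-z)Ee^{-zz'}e_M(zz')$; $\widetilde{IS}_{2M}(z,z')=-\frac{e^{-\frac12(\overline z-\overline z')^2}}{\sqrt{2\pi}}(\overline z'-\overline z)Ee^{-\overline z\,\overline z'}e_M(\overline z\,\overline z')$. Real/complex, with $E_1=\sqrt{\operatorname{erfc}(\sqrt2\operatorname{Im}z)}$: $\widetilde S_{2M}(x,z)=\frac{ie^{-\frac12(x-\overline z)^2}}{\sqrt{2\pi}}(\overline z-x)E_1e^{-x\overline z}e_M(x\overline z)$; $\widetilde S_{2M}(z,x)=\frac{e^{-\frac12(x-z)^2}}{\sqrt{2\pi}}E_1e^{-xz}e_M(xz)+r_M(z,x)$; $\widetilde{DS}_{2M}(x,z)=\frac{e^{-\frac12(x-z)^2}}{\sqrt{2\pi}}(z-x)E_1e^{-xz}e_M(xz)$;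 $\widetilde{IS}_{2M}(x,z)=-\frac{ie^{-\frac12(x-\overline z)^2}}{\sqrt{2\pi}}E_1e^{-x\overline z}e_M(x\overline z)-ir_M(\overline z,x)$. *)

(* Defs.v *)
From HB Require Import structures.
From mathcomp Require Import all_boot all_order all_algebra.
From mathcomp Require Import all_classical all_reals all_analysis.

Set Implicit Arguments.
Unset Strict Implicit.
Unset Printing Implicit Defensive.

Import Order.TTheory GRing.Theory Num.Theory.
Import numFieldNormedType.Exports.
From mathcomp Require Import complex.

Local Open Scope classical_set_scope.
Local Open Scope ring_scope.
Local Open Scope complex_scope.

Definition mx2 (T : Type) (a b c d : T) : 'M[T]_2 :=
  \matrix_(i < 2, j < 2)
    if i == 0 then (if j == 0 then a else b) else (if j == 0 then c else d).

(* e^(a + ib) = e^a (cos b + i sin b) *)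
Definition cexp (R : realType) (z : R[i]) : R[i] :=
  (expR (Re z))%:C * (cos (Im z) +i* sin (Im z)).

Definition erfc (R : realType) (x : R) : R :=
  2 / Num.sqrt pi *
  \int[lebesgue_measure]_(t in `[x, +oo[) expR (- t ^+ 2).

Definition lower_gamma (R : realType) (a x : R) : R :=
  \int[lebesgue_measure]_(t in `[0, x]) (t `^ (a - 1) * expR (- t)).

Definition cM (F : numFieldType) (M : nat) (y : F) : F :=
  \sum_(k < M) y ^+ (2 * k) / ((2 * k)`!)%:R.

(* The terms k = 0, ..., 2M-2.  For M = 0, a value which is irrelevant to the
   limit, this sum is empty; similarly the truncated 2M-2 and 2M-1 below are
   only meaningful for M >= 1. *)
Definition eM (F : numFieldType) (M : nat) (y : F) : F :=
  \sum_(k < (2 * M - 1)%N) y ^+ k / (k`!)%:R.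

Section Kernel.
Context {R : realType}.
Implicit Types (M : nat) (x : R) (z g : R[i]).

Definition sqrt2pi : R := Num.sqrt (2 * pi).

Definition rM M z x : R[i] :=
  cexp (- z ^+ 2 / 2) / sqrt2pi%:C
  * (Num.sqrt (erfc (Num.sqrt 2 * `|Im z|)))%:C
  * (2 `^ (M%:R - 3 / 2) / ((2 * M - 2)`!)%:R)%:C
  * (Num.sg x)%:C * z ^+ (2 * M - 1)
  * (lower_gamma (M%:R - 1 / 2) (x ^+ 2 / 2))%:C.

(* sqrt (erfc (sqrt2 Im z)) *)
Definition E1 z : R := Num.sqrt (erfc (Num.sqrt 2 * Im z)).

(* sqrt (erfc (sqrt2 Im z) erfc (sqrt2 Im z')) *)
Definition E2 z z' : R :=
  Num.sqrt (erfc (Num.sqrt 2 * Im z) * erfc (Num.sqrt 2 * Im z')).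

(* In the names below, r stands for a real argument and c for an argument in
   the open upper half plane. *)

Definition S_rr M x x' : R[i] :=
  (expR (- (x - x') ^+ 2 / 2) / sqrt2pi * expR (- (x * x')) * eM M (x * x'))%:C
  + rM M x%:C x'.

Definition DS_rr M x x' : R[i] :=
  (expR (- (x - x') ^+ 2 / 2) / sqrt2pi * (x' - x)
   * expR (- (x * x')) * eM M (x * x'))%:C.

(* e^(-x^2/2) / (2 sqrt pi) sgn x' *
   int_0^(x'^2/2) e^(-t) / sqrt t * c_M (x sqrt (2t)) dt;
   the integrand is 0 at t = 0, as 1/0 = 0, which does not affect the
   integral. *)
Definition IS_rr_half M x x' : R :=
  expR (- x ^+ 2 / 2) / (2 * Num.sqrt pi) * Num.sg x'
  * \int[lebesgue_measure]_(t in `[0, (x' ^+ 2 / 2)])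
      (expR (- t) / Num.sqrt t * cM M (x * Num.sqrt (2 * t))).

Definition IS_rr M x x' : R[i] :=
  (IS_rr_half M x x' - IS_rr_half M x' x)%:C.

Definition S_cc M z z' : R[i] :=
  'i * cexp (- (z - z'^*) ^+ 2 / 2) / sqrt2pi%:C * (z'^* - z) * (E2 z z')%:C
  * cexp (- (z * z'^*)) * eM M (z * z'^*).

Definition DS_cc M z z' : R[i] :=
  cexp (- (z - z') ^+ 2 / 2) / sqrt2pi%:C * (z' - z) * (E2 z z')%:C
  * cexp (- (z * z')) * eM M (z * z').

Definition IS_cc M z z' : R[i] :=
  - (cexp (- (z^* - z'^*) ^+ 2 / 2) / sqrt2pi%:C * (z'^* - z^*) * (E2 z z')%:C
     * cexp (- (z^* * z'^*)) * eM M (z^* * z'^*)).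

Definition S_rc M x z : R[i] :=
  'i * cexp (- (x%:C - z^*) ^+ 2 / 2) / sqrt2pi%:C * (z^* - x%:C) * (E1 z)%:C
  * cexp (- (x%:C * z^*)) * eM M (x%:C * z^*).

Definition S_cr M z x : R[i] :=
  cexp (- (x%:C - z) ^+ 2 / 2) / sqrt2pi%:C * (E1 z)%:C
  * cexp (- (x%:C * z)) * eM M (x%:C * z)
  + rM M z x.

Definition DS_rc M x z : R[i] :=
  cexp (- (x%:C - z) ^+ 2 / 2) / sqrt2pi%:C * (z - x%:C) * (E1 z)%:C
  * cexp (- (x%:C * z)) * eM M (x%:C * z).

Definition IS_rc M x z : R[i] :=
  - ('i * cexp (- (x%:C - z^*) ^+ 2 / 2) / sqrt2pi%:C * (E1 z)%:C
     * cexp (- (x%:C * z^*)) * eM M (x%:C * z^*))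
  - 'i * rM M z^* x.

(* The arguments of the kernel range over the union of the real line and the
   open upper half plane, i.e., over [0 <= Im g]; they are real iff
   [Im g == 0]. *)

Definition S_ M g g' : R[i] :=
  if Im g == 0 then
    if Im g' == 0 then S_rr M (Re g) (Re g') else S_rc M (Re g) g'
  else
    if Im g' == 0 then S_cr M g (Re g') else S_cc M g g'.

(* The complex/real entries of DS and IS are determined by the real/complex
   ones since a Pfaffian kernel is skew: K(g', g) = - K(g, g')^T. *)

Definition DS_ M g g' : R[i] :=
  if Im g == 0 then
    if Im g' == 0 then DS_rr M (Re g) (Re g') else DS_rc M (Re g) g'
  else
    if Im g' == 0 then - DS_rc M (Re g') g else DS_cc M g g'.

Definition IS_ M g g' : R[i] :=
  if Im g == 0 then
    if Im g' == 0 then IS_rr M (Re g) (Re g') else IS_rc M (Re g) g'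
  else
    if Im g' == 0 then - IS_rc M (Re g') g else IS_cc M g g'.

Definition Eps g g' : R[i] :=
  if (Im g == 0) && (Im g' == 0) then (Num.sg (Re g - Re g') / 2)%:C else 0.

(* The kernel for 2M x 2M matrices. *)
Definition Ktilde M g g' : 'M[R[i]]_2 :=
  mx2 (DS_ M g g')    (S_ M g g')
      (- S_ M g' g)   (IS_ M g g' + Eps g g').

End Kernel.

(* Main.v *)
(* Every entry of the kernel except IS(x, x') is a constant times
   e^(-w) e_M(w), which tends to that constant, plus a remainder r_M, which
   vanishes because (2M-2)! beats the geometric growth of the other factors.
   In IS(x, x') monotone convergence replaces c_M by cosh; after t = s^2/2 the
   integrals become Gaussian and
   IS(x, x') --> (erfc((x-x')/sqrt 2) - erfc((x'-x)/sqrt 2)) / 4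
             = (erfc((x-x')/sqrt 2) - 1) / 2,
   which combines with sgn(x-x') / 2 by the symmetry erfc(-y) = 2 - erfc(y). *)
Require Import Defs.
From HB Require Import structures.
From mathcomp Require Import all_boot all_order all_algebra.
From mathcomp Require Import all_classical all_reals all_analysis.
From mathcomp Require Import measurable_realfun ring lra.

Set Implicit Arguments.
Unset Strict Implicit.
Unset Printing Implicit Defensive.

Import Order.TTheory GRing.Theory Num.Theory.
Import numFieldNormedType.Exports.
From mathcomp Require Import complex.

Local Open Scope classical_set_scope.
Local Open Scope ring_scope.
Local Open Scope complex_scope.

(** * Derivative and reflection symmetry of erfc *)

Section Erfc.
Context {R : realType}.
Implicit Types x y t : R.
Local Notation mu := (@lebesgue_measure R).

(** Up to the factor 2 / sqrt pi, erfc is the total Gaussian mass minus the primitive [F] started at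
    -oo, and the first fundamental theorem differentiates [F]. *)
Lemma is_derive_erfc y :
  is_derive y 1 (@erfc R) (- (2 / Num.sqrt pi * expR (- y ^+ 2))).
Proof.
have igT (A : set R) : measurable A -> mu.-integrable A (EFin \o gauss_fun).
  by move=> mA; apply: integrableS integrableT_gauss.
pose F x := \int[mu]_(t in `]-oo, x]) gauss_fun t.
have [dF F'] : derivable F y 1 /\ derive1 F y = gauss_fun y.
  apply: (@continuous_FTC1 R gauss_fun -oo%O y (y + 1)).
  - by rewrite ltrDl.
  - by apply: igT; exact: measurable_itv.
  - by rewrite /Order.lt/=.
  - exact: continuous_gauss_fun.
have erfcE : @erfc R = fun x =>
    2 / Num.sqrt pi * (\int[mu]_(t in `]-oo, +oo[) gauss_fun t - F x).
  apply/funext => x; rewrite /erfc; congr (_ * _).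
  rewrite /F Rintegral_itvB//; last exact: igT.
  by rewrite Rintegral_itv_obnd_cbnd//; exact: igT.
have isF : is_derive y 1 F (gauss_fun y).
  by rewrite -F' derive1E; apply: derivableP.
rewrite erfcE; apply: is_derive_eq.
by rewrite add0r mul1r scalerN.
Qed.

Lemma erfc0 : erfc (0 : R) = 1.
Proof.
rewrite /erfc (_ : Rintegral _ _ _ = Num.sqrt pi / 2).
  by field; rewrite sqrtr_eq0 -ltNge pi_gt0.
by rewrite /Rintegral integral0y_gauss.
Qed.

(** The Gaussian is even, so [erfc u + erfc (- u)] has zero derivative and keeps its value 2 at u =
    0. *)
Lemma erfcN y : erfc (- y) = 2 - erfc y.
Proof.
have H x : is_derive x 1 (fun u : R => erfc u + erfc (- u)) 0.
  have h1 := is_derive_erfc x; have h2 := is_derive_erfc (- x).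
  have h3 : is_derive x 1 (fun u : R => erfc (- u))
      (- (2 / Num.sqrt pi * expR (- (- x) ^+ 2)) * - 1).
    exact: (@is_derive1_comp _ (@erfc R) (fun u => - u)).
  apply: is_derive_eq; rewrite sqrrN; ring.
have := is_derive_0_is_cst y 0 H; rewrite oppr0 erfc0 => E.
lra.
Qed.

End Erfc.

(** * Fundamental theorem for an integrand that may blow up at the left endpoint *)

Section ImproperFTC.
Context {R : realType}.
Local Notation mu := (@lebesgue_measure R).

(** Meant for integrands like 1 / sqrt t at 0. The intervals [c n, b] increase to ]a, b], and
    nonnegativity of [f] lets the integrals over them pass to the limit. *)
Lemma ge0_continuous_FTC2_obnd (f F : R -> R) (a b : R) : a < b ->
  (forall x, a < x -> 0 <= f x) ->
  (forall x, a < x -> {for x, continuous f}) ->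
  (forall x, a < x -> is_derive x 1 F (f x)) ->
  F x @[x --> a^'+] --> F a ->
  (\int[mu]_(x in `[a, b]) (f x)%:E = (F b - F a)%:E)%E.
Proof.
move=> ab f0 cf dF Fa.
(* The points [c n] decrease to a; the factor 1/2 keeps even [c 0] strictly below b. *)
pose c (n : nat) : R := a + (b - a) / 2 * harmonic n.
have ba0 : 0 < (b - a) / 2 by rewrite divr_gt0// subr_gt0.
have ac n : a < c n by rewrite /c ltrDl mulr_gt0// invr_gt0.
have cb n : c n < b.
  rewrite /c -ltrBrDl (@le_lt_trans _ _ ((b - a) / 2))//.
    by rewrite ler_piMr ?(ltW ba0)// invf_le1// ler1n.
  by rewrite ltr_pdivrMr// ltr_pMr ?subr_gt0// ltr1n.
have c_cvg : c n @[n --> \oo] --> a.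
  rewrite -[X in _ --> X]addr0 -[X in _ --> a + X](mulr0 ((b - a) / 2)).
  apply: cvgD; first exact: cvg_cst.
  by apply: cvgM; [exact: cvg_cst|exact: cvg_harmonic].
have cc n m : (n <= m)%N -> c m <= c n.
  move=> nm; rewrite lerD2l ler_wpM2l ?(ltW ba0)//.
  by rewrite lef_pV2 ?posrE// ler_nat.
have UE : \bigcup_n `[c n, b]%classic = `]a, b]%classic.
  apply/seteqP; split => [x [n _]|x] /=; rewrite !in_itv/= => /andP[cx xb].
    by rewrite xb (lt_le_trans (ac n)).
  have [n _ /(_ n (leqnn n)) cn] := cvgr_lt a c_cvg x cx.
  by exists n => //=; rewrite in_itv/= xb (ltW cn).
have mf : measurable_fun `]a, b] f.
  apply: (@measurable_funS _ _ _ _ `]a, +oo[%classic) => //.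
    by apply: subset_itvl.
  apply: open_continuous_measurable_fun => //.
  by move=> x; rewrite inE/= in_itv/= andbT; exact: cf.
rewrite -integral_itv_obnd_cbnd; last exact/measurable_EFinP.
have : (\int[mu]_(x in `[c n, b]) (f x)%:E)%E @[n --> \oo] -->
    (\int[mu]_(x in `]a, b]) (f x)%:E)%E.
  rewrite -UE; apply: ge0_nondecreasing_set_cvg_integral => //.
  - move=> n m nm; rewrite subsetEset; apply: subset_itvr.
    by rewrite bnd_simp cc.
  - move=> n; apply/measurable_EFinP.
    apply: measurable_funS mf => //; apply: subset_itvr.
    by rewrite bnd_simp ac.
  - move=> n x /=; rewrite in_itv/= => /andP[cx _].
    by rewrite lee_fin f0// (lt_le_trans (ac n)).
(* The same integrals equal F b - F (c n) by the ordinary theorem on [c n, b], and F (c n) tends to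
   F a along the sequence [c]. *)
move/cvg_unique; apply => //.
have -> : (fun n => \int[mu]_(x in `[c n, b]) (f x)%:E)%E =
    EFin \o (fun n => F b - F (c n)).
  apply/funext => n /=; rewrite (@continuous_FTC2 _ f F)//.
  - apply: continuous_in_subspaceT => x; rewrite inE/= in_itv/= => /andP[cx _].
    by apply: cf; exact: lt_le_trans cx.
  - have cF x : a < x -> {for x, continuous F}.
      by move=> /dF[? _]; exact/differentiable_continuous/derivable1_diffP.
    split.
    + move=> x; rewrite in_itv/= => /andP[cx _].
      by have [] := dF x (lt_trans (ac n) cx).
    + by apply: cvg_at_right_filter; exact: cF.
    + by apply: cvg_at_left_filter; apply: cF; exact: lt_trans (cb n).
  - move=> x; rewrite in_itv/= => /andP[cx _].
    by rewrite derive1E; apply: derive_val; apply: dF; exact: lt_trans cx.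
apply: cvg_EFin; first exact: nearW.
apply: cvgB; first exact: cvg_cst.
move/cvg_at_rightP : Fa; apply; split => //.
Qed.

End ImproperFTC.

(** * The polynomials c_M as partial sums of cosh *)

Section HyperbolicSeries.
Context {R : realType}.
Implicit Types x y t : R.

(** In the sum of the exponential series at y and at -y the odd terms cancel and the even ones
    double; the first 2M terms contain exactly M even ones. *)
Lemma cM_series M y :
  cM M y = (series (exp_coeff y) (2 * M)%N + series (exp_coeff (- y)) (2 * M)%N) / 2.
Proof.
rewrite /cM; elim: M => [|M IH].
  by rewrite big_ord0 /series /= !big_geq// addr0 mul0r.
rewrite big_ord_recr /= IH mulnS !addSn add0n /series /=.
rewrite !big_nat_recr//= /exp_coeff /=.
have -> : (- y) ^+ (2 * M) = y ^+ (2 * M) by rewrite !exprM sqrrN.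
have -> : (- y) ^+ (2 * M).+1 = - y ^+ (2 * M).+1.
  by rewrite !exprS !exprM sqrrN mulNr.
rewrite mulNr; move: (y ^+ _ / _) (y ^+ _ / _) => u v.
by move: (\sum_(_ <= _ < _) _) (\sum_(_ <= _ < _) _) => a b; lra.
Qed.

Lemma cM_ge0 M y : 0 <= cM M y.
Proof.
apply: sumr_ge0 => k _; apply: divr_ge0 => //.
by rewrite exprM exprn_ge0// sqr_ge0.
Qed.

Lemma cvg_cM y : cM M y @[M --> \oo] --> (expR y + expR (- y)) / 2.
Proof.
under eq_fun do rewrite cM_series.
have h : (2 * M)%N @[M --> \oo] --> \oo.
  exact: cvg_mulnl.
have e z : series (exp_coeff z) (2 * M)%N @[M --> \oo] --> expR z.
  by apply: (cvg_comp _ _ h); exact: is_cvg_series_exp_coeff.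
by apply: cvgM; [apply: cvgD; exact: e|exact: cvg_cst].
Qed.

Lemma nondecreasing_cM y : nondecreasing_seq (fun M => cM M y).
Proof.
apply/nondecreasing_seqP => M; rewrite /cM big_ord_recr /= lerDl.
by rewrite divr_ge0// exprM exprn_ge0// sqr_ge0.
Qed.

End HyperbolicSeries.

(** * Limit of the real/real entry IS *)

Section RealRealIS.
Context {R : realType}.
Implicit Types x y t : R.
Local Notation mu := (@lebesgue_measure R).

(* The limiting integrand cosh(x sqrt(2t)) e^(-t) / sqrt t: in the variable
   s = sqrt(2t) it is a combination of Gaussian densities centred at x and -x,
   hence has a primitive in terms of erfc. *)
Definition gauss_cosh x t : R :=
  expR (- t) / Num.sqrt t *
  ((expR (x * Num.sqrt (2 * t)) + expR (- (x * Num.sqrt (2 * t)))) / 2).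

(** Completing the square: with c = x / sqrt 2 and s = sqrt t, the exponent -(c -+ s)^2 equals
    -x^2/2 - t +- x sqrt(2t), and the chain rule contributes 1 / (2s). *)
Lemma is_derive_erfc_sqrt x t : 0 < t ->
  is_derive t 1 (fun u => erfc (x / Num.sqrt 2 - Num.sqrt u) -
                          erfc (x / Num.sqrt 2 + Num.sqrt u))
    (2 / (Num.sqrt pi * expR (x ^+ 2 / 2)) * gauss_cosh x t).
Proof.
move=> t0; rewrite /gauss_cosh.
have ds := is_derive1_sqrt t0.
set c := x / Num.sqrt 2; set s := Num.sqrt t.
have s0 : s != 0 by rewrite gt_eqF// sqrtr_gt0.
have p0 : Num.sqrt pi != 0 :> R by rewrite gt_eqF// sqrtr_gt0 pi_gt0.
have hm : is_derive t 1 (fun u => erfc (c - Num.sqrt u))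
    (- (2 / Num.sqrt pi * expR (- (c - s) ^+ 2)) * (0 - (2 * s)^-1)).
  apply: (@is_derive1_comp _ (@erfc R) (fun u => c - Num.sqrt u)).
  exact: is_derive_erfc.
have hp : is_derive t 1 (fun u => erfc (c + Num.sqrt u))
    (- (2 / Num.sqrt pi * expR (- (c + s) ^+ 2)) * (0 + (2 * s)^-1)).
  apply: (@is_derive1_comp _ (@erfc R) (fun u => c + Num.sqrt u)).
  exact: is_derive_erfc.
have c2 : c ^+ 2 = x ^+ 2 / 2 by rewrite expr_div_n sqr_sqrtr.
have cs : 2 * (c * s) = x * Num.sqrt (2 * t).
  have q0 : Num.sqrt 2 != 0 :> R by rewrite gt_eqF// sqrtr_gt0.
  rewrite sqrtrM// -/s -[X in X * (c * s)](@sqr_sqrtr _ (2 : R))// /c.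
  by field.
have s2 : s ^+ 2 = t by rewrite sqr_sqrtr ?ltW.
have em : expR (- (c - s) ^+ 2) =
    expR (- t) * expR (x * Num.sqrt (2 * t)) / expR (x ^+ 2 / 2).
  rewrite -expRN -!expRD -cs -c2 -s2; congr expR; ring.
have ep : expR (- (c + s) ^+ 2) =
    expR (- t) * expR (- (x * Num.sqrt (2 * t))) / expR (x ^+ 2 / 2).
  rewrite -expRN -!expRD -cs -c2 -s2; congr expR; ring.
have e0 : expR (x ^+ 2 / 2) != 0 by rewrite expR_eq0.
apply: is_derive_eq; rewrite em ep.
by field; rewrite e0 p0 s0.
Qed.

Lemma gauss_cosh_ge0 x t : 0 <= gauss_cosh x t.
Proof.
by rewrite mulr_ge0 ?divr_ge0 ?addr_ge0 ?expR_ge0 ?sqrtr_ge0.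
Qed.

(** The primitive [F] vanishes at 0, where its two erfc terms agree, and sqrt(b^2/2) = b / sqrt 2.
    The improper fundamental theorem is used because sqrt t is not differentiable at 0. *)
Lemma integral_gauss_cosh x (b : R) : 0 < b ->
  (\int[mu]_(t in `[0%R, (b ^+ 2 / 2)%R]) (gauss_cosh x t)%:E)%E =
  (Num.sqrt pi * expR (x ^+ 2 / 2) / 2 *
    (erfc ((x - b) / Num.sqrt 2) - erfc ((x + b) / Num.sqrt 2)))%:E.
Proof.
move=> b0.
have p0 : Num.sqrt pi != 0 :> R by rewrite gt_eqF// sqrtr_gt0 pi_gt0.
have e0 : expR (x ^+ 2 / 2) != 0 by rewrite expR_eq0.
(* The inverse of the factor in front of [gauss_cosh] in [is_derive_erfc_sqrt]. *)
pose k : R := Num.sqrt pi * expR (x ^+ 2 / 2) / 2.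
pose F t := k * (erfc (x / Num.sqrt 2 - Num.sqrt t) -
                 erfc (x / Num.sqrt 2 + Num.sqrt t)).
have cs t : {for t, continuous (fun u : R => Num.sqrt u)}.
  exact: sqrt_continuous.
have ce : continuous (@erfc R).
  move=> y; apply/differentiable_continuous/derivable1_diffP.
  by have [] := is_derive_erfc y.
transitivity ((F (b ^+ 2 / 2) - F 0)%:E); last first.
  have -> : F 0 = 0 by rewrite /F sqrtr0 addr0 subr0 subrr mulr0.
  rewrite subr0 /F sqrtrM ?sqr_ge0// sqrtr_sqr ger0_norm ?(ltW b0)//.
  by rewrite sqrtrV// -mulrBl -mulrDl.
apply: ge0_continuous_FTC2_obnd.
- by rewrite divr_gt0// exprn_gt0.
- by move=> t _; exact: gauss_cosh_ge0.
- move=> t t0; rewrite /gauss_cosh.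
  have c2 : {for t, continuous (fun u : R => x * Num.sqrt (2 * u))}.
    apply: cvgM; first exact: cvg_cst.
    apply: (@continuous_comp _ _ _ (fun u : R => 2 * u) Num.sqrt).
      by apply: cvgM; [exact: cvg_cst|exact: cvg_id].
    exact: cs.
  apply: cvgM.
    apply: cvgM.
      apply: (@continuous_comp _ _ _ (fun u : R => - u) expR).
        by apply: cvgN; exact: cvg_id.
      exact: continuous_expR.
    by apply: cvgV; [rewrite gt_eqF// sqrtr_gt0|exact: cs].
  apply: cvgM; last exact: cvg_cst.
  apply: cvgD.
    apply: (@continuous_comp _ _ _ (fun u : R => x * Num.sqrt (2 * u)) expR) => //.
    exact: continuous_expR.
  apply: (@continuous_comp _ _ _ (fun u : R => - (x * Num.sqrt (2 * u))) expR).
    by apply: cvgN; exact: c2.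
  exact: continuous_expR.
- move=> t t0; have dF := is_derive_erfc_sqrt x t0.
  apply: is_derive_eq; rewrite /GRing.scale/= /k.
  by field; rewrite p0 e0.
- apply: cvg_at_right_filter; apply: cvgM; first exact: cvg_cst.
  apply: cvgB.
    apply: (@continuous_comp _ _ _ (fun u => x / Num.sqrt 2 - Num.sqrt u)).
      by apply: cvgB; [exact: cvg_cst|exact: cs].
    exact: ce.
  apply: (@continuous_comp _ _ _ (fun u => x / Num.sqrt 2 + Num.sqrt u)).
    by apply: cvgD; [exact: cvg_cst|exact: cs].
  exact: ce.
Qed.

Lemma cvg_IS_rr_half x x' :
  IS_rr_half M x x' @[M --> \oo] -->
    (erfc ((x - x') / Num.sqrt 2) - erfc ((x + x') / Num.sqrt 2)) / 4.
Proof.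
(* At x' = 0 the factor sgn 0 = 0 annihilates the left side; otherwise the closed form applies with
   b = |x'|. *)
have [->|x'0] := eqVneq x' 0.
  rewrite subr0 addr0 subrr mul0r (_ : (fun M => _) = cst 0).
    exact: cvg_cst.
  by apply/funext => M; rewrite /IS_rr_half sgr0 mulr0 mul0r.
have n0 : 0 < `|x'| by rewrite normr_gt0.
pose g M t := expR (- t) / Num.sqrt t * cM M (x * Num.sqrt (2 * t)).
have h : (\int[mu]_(t in `[0%R, (x' ^+ 2 / 2)%R]) (g M t)%:E)%E @[M --> \oo] -->
    (Num.sqrt pi * expR (x ^+ 2 / 2) / 2 * (erfc ((x - `|x'|) / Num.sqrt 2) -
      erfc ((x + `|x'|) / Num.sqrt 2)))%:E.
  rewrite -integral_gauss_cosh// real_normK ?num_real//.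
  (* The target is written as the integral of the pointwise limit, the form monotone convergence
     yields. *)
  have -> : (\int[mu]_(t in `[0%R, (x' ^+ 2 / 2)%R]) (gauss_cosh x t)%:E)%E =
      (\int[mu]_(t in `[0%R, (x' ^+ 2 / 2)%R]) limn (fun M => (g M t)%:E))%E.
    apply: eq_integral => t _; apply/esym/cvg_lim => //.
    apply: cvg_EFin; first exact: nearW.
    by apply: cvgM; [exact: cvg_cst|exact: cvg_cM].
  have w t : 0 <= expR (- t) / Num.sqrt t.
    by rewrite divr_ge0 ?expR_ge0 ?sqrtr_ge0.
  have ms : measurable_fun [set: R] (fun t : R => Num.sqrt t).
    by apply: continuous_measurable_fun; exact: sqrt_continuous.
  (* Continuity gives measurability on the open half-line only; adding the endpoint 0 preserves
     it. *)
  have mV : measurable_fun `[0, x' ^+ 2 / 2] (fun t : R => (Num.sqrt t)^-1).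
    apply/measurable_fun_itv_obnd_cbndP.
    apply: (@measurable_funS _ _ _ _ (`]0%R, +oo[%classic : set R)) => //.
      by apply: subset_itvl.
    apply: open_continuous_measurable_fun => // t.
    rewrite inE/= in_itv/= andbT => t0.
    by apply: cvgV; [rewrite gt_eqF// sqrtr_gt0|exact: sqrt_continuous].
  apply: cvg_monotone_convergence => //.
  - move=> M; apply/measurable_EFinP.
    apply: measurable_funM.
      by apply: measurable_funM => //; apply: measurable_funTS;
         apply: measurableT_comp.
    apply: measurable_funTS; rewrite /cM; apply: measurable_sum => k.
    apply: measurable_funM => //; apply: measurable_funX.
    apply: measurable_funM => //.
    by apply: (measurableT_comp ms); apply: measurable_funM.
  - by move=> M t _; rewrite lee_fin mulr_ge0 ?cM_ge0.
  - move=> t _ n m nm; rewrite lee_fin ler_wpM2l//.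
    exact: nondecreasing_cM.
have hr : \int[mu]_(t in `[0%R, (x' ^+ 2 / 2)%R]) (g M t) @[M --> \oo] -->
    (Num.sqrt pi * expR (x ^+ 2 / 2) / 2 * (erfc ((x - `|x'|) / Num.sqrt 2) -
      erfc ((x + `|x'|) / Num.sqrt 2))).
  exact: fine_cvg h.
rewrite [X in _ --> X](_ : _ = expR (- x ^+ 2 / 2) / (2 * Num.sqrt pi) *
    Num.sg x' * (Num.sqrt pi * expR (x ^+ 2 / 2) / 2 *
    (erfc ((x - `|x'|) / Num.sqrt 2) - erfc ((x + `|x'|) / Num.sqrt 2)))).
  by apply: cvgM; [exact: cvg_cst|exact: hr].
have p0 : Num.sqrt pi != 0 :> R by rewrite gt_eqF// sqrtr_gt0 pi_gt0.
have e0 : expR (x ^+ 2 / 2) != 0 by rewrite expR_eq0.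
(* For x' < 0, putting |x'| = -x' exchanges the two erfc terms, and sgn x' = -1 restores their
   order. *)
rewrite mulNr expRN; case: (ltrgt0P x') x'0 => // x'0 _.
  by rewrite gtr0_sg//; field; rewrite p0 e0.
by rewrite ltr0_sg// opprK; field; rewrite p0 e0.
Qed.

Lemma cvg_IS_rr x x' :
  IS_rr_half M x x' - IS_rr_half M x' x + Num.sg (x - x') / 2 @[M --> \oo] -->
    1 / 2 * Num.sg (x - x') * erfc (`|x - x'| / Num.sqrt 2).
Proof.
rewrite [X in _ --> X](_ : _ =
    (erfc ((x - x') / Num.sqrt 2) - erfc ((x + x') / Num.sqrt 2)) / 4 -
    (erfc ((x' - x) / Num.sqrt 2) - erfc ((x' + x) / Num.sqrt 2)) / 4 +
    Num.sg (x - x') / 2).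
  apply: cvgD; last exact: cvg_cst.
  by apply: cvgB; exact: cvg_IS_rr_half.
rewrite (addrC x' x) -(opprB x x') mulNr erfcN.
(* The contributions of x + x' from the two halves cancel, so their value can be arbitrary. *)
move: (erfc ((x + x') / _)) => e.
case: (ltrgt0P (x - x')) => d0.
- by rewrite gtr0_sg//; lra.
- by rewrite ltr0_sg// mulNr erfcN; lra.
- by rewrite d0 sgr0 mul0r erfc0; lra.
Qed.

End RealRealIS.

(** * Real and imaginary parts against the complex modulus *)

Section ComplexParts.
Context {R : rcfType}.
Implicit Types (a b : R) (w z : R[i]).

Lemma ReM w z : Re (w * z) = Re w * Re z - Im w * Im z.
Proof. by case: w z => [? ?] [? ?]. Qed.

Lemma ImM w z : Im (w * z) = Re w * Im z + Im w * Re z.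
Proof. by case: w z => [? ?] [? ?]. Qed.

Lemma ReD w z : Re (w + z) = Re w + Re z.
Proof. by case: w z => [? ?] [? ?]. Qed.

Lemma ImD w z : Im (w + z) = Im w + Im z.
Proof. by case: w z => [? ?] [? ?]. Qed.

Lemma ReN w : Re (- w) = - Re w. Proof. by case: w. Qed.

Lemma ImN w : Im (- w) = - Im w. Proof. by case: w. Qed.

Lemma normr_real_complex a : `|a%:C| = `|a|%:C :> R[i].
Proof. by rewrite normc_def /= expr0n addr0 sqrtr_sqr. Qed.

Lemma normc_le_ReIm w : `|w| <= (`|Re w| + `|Im w|)%:C.
Proof.
rewrite {1}[w]complexE (le_trans (ler_normD _ _))// normrM.
rewrite !normr_real_complex rmorphD/= lerD2l ler_piMl//; first by rewrite ler0c.
by rewrite normc_def /= expr0n expr1n add0r sqrtr1.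
Qed.

Lemma normRe_le w a : `|w| <= a%:C -> `|Re w| <= a.
Proof. by move=> wa; rewrite -lecR (le_trans _ wa)// normc_ge_Re. Qed.

Lemma normIm_le w a : `|w| <= a%:C -> `|Im w| <= a.
Proof.
move=> wa; rewrite -normrN -ReiNIm; apply: normRe_le.
by rewrite normrM [X in _ * X]normc_def /= expr0n expr1n add0r sqrtr1 mulr1.
Qed.

End ComplexParts.

(** * Componentwise convergence of complex sequences *)

Section ComplexCvg.
Context {R : realType}.
Implicit Types (u v : R[i] ^nat) (z l : R[i]).

(* Limits in R[i] are handled through their real and imaginary parts, and
   likewise for derivatives of functions R -> R[i] below: R[i] is not declared
   as a normed module over R. *)
Definition cvg_ReIm u l :=
  (@Re R \o u @ \oo --> Re l) /\ (@Im R \o u @ \oo --> Im l).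

Lemma cvg_ReImP u l : cvg_ReIm u l -> (u : (R[i]^o)^nat) @ \oo --> (l : R[i]^o).
Proof.
move=> [ur ui]; apply/cvgrPdist_lt => -[e e'].
(* In the partial order of [R[i]] a positive radius has zero imaginary part, so it is a positive
   real. *)
rewrite ltcE /= => /andP[/eqP-> e0].
have e2 : 0 < e / 2 by rewrite divr_gt0.
near=> n.
rewrite (le_lt_trans (normc_le_ReIm _))// ltcR.
rewrite ReD ReN ImD ImN [ltRHS](splitr e) ltrD//.
  by near: n; move/cvgrPdist_lt : ur; exact.
by near: n; move/cvgrPdist_lt : ui; exact.
Unshelve. all: by end_near. Qed.

Lemma cvg_ReIm_eq u l z : cvg_ReIm u l -> l = z -> cvg_ReIm u z.
Proof. by move=> + <-. Qed.

Lemma cvg_ReIm_cst z : cvg_ReIm (fun=> z) z.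
Proof. by split; exact: cvg_cst. Qed.

Lemma cvg_ReImD u v l z : cvg_ReIm u l -> cvg_ReIm v z ->
  cvg_ReIm (fun n => u n + v n) (l + z).
Proof.
move=> [ur ui] [vr vi]; split.
  by rewrite /comp ReD; under eq_fun do rewrite ReD; exact: cvgD.
by rewrite /comp ImD; under eq_fun do rewrite ImD; exact: cvgD.
Qed.

Lemma cvg_ReImM u v l z : cvg_ReIm u l -> cvg_ReIm v z ->
  cvg_ReIm (fun n => u n * v n) (l * z).
Proof.
move=> [ur ui] [vr vi]; split.
  rewrite /comp ReM; under eq_fun do rewrite ReM.
  by apply: cvgB; exact: cvgM.
rewrite /comp ImM; under eq_fun do rewrite ImM.
by apply: cvgD; exact: cvgM.
Qed.

Lemma cvg_ReImN u l : cvg_ReIm u l -> cvg_ReIm (fun n => - u n) (- l).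
Proof.
move=> [ur ui]; split.
  by rewrite /comp ReN; under eq_fun do rewrite ReN; exact: cvgN.
by rewrite /comp ImN; under eq_fun do rewrite ImN; exact: cvgN.
Qed.

(** Discards the initial indices, at which truncated subtractions such as [2 * M - 1] or small gamma
    exponents would need separate treatment. *)
Lemma cvg_ReIm_shiftS u l : cvg_ReIm (fun n => u n.+1) l -> cvg_ReIm u l.
Proof. by move=> [ur ui]; split; rewrite -cvg_shiftS. Qed.

Lemma cvg_ReIm_real (r : R ^nat) (a : R) : r @ \oo --> a ->
  cvg_ReIm (fun n => (r n)%:C) a%:C.
Proof. by move=> ra; split=> //=; exact: cvg_cst. Qed.

Lemma cvg_ReIm_dominated u l (r : R ^nat) :
  (\forall n \near \oo, `|u n - l| <= (r n)%:C) -> r @ \oo --> 0 ->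
  cvg_ReIm u l.
Proof.
move=> ur r0; split.
  apply/cvgrPdist_le => e e0.
  near=> n; rewrite distrC /= -ReN -ReD (@le_trans _ _ (r n))//.
    by apply: normRe_le; near: n.
  near: n.
  by move/cvgrPdist_le : r0 => /(_ e e0); apply: filterS => n;
     rewrite sub0r normrN; apply: le_trans; rewrite ler_norm.
apply/cvgrPdist_le => e e0.
near=> n; rewrite distrC /= -ImN -ImD (@le_trans _ _ (r n))//.
  by apply: normIm_le; near: n.
near: n.
by move/cvgrPdist_le : r0 => /(_ e e0); apply: filterS => n;
   rewrite sub0r normrN; apply: le_trans; rewrite ler_norm.
Unshelve. all: by end_near. Qed.

End ComplexCvg.

(** * Convergence of e^(-z) e_M(z) to 1 *)

Section ComplexExp.
Context {R : realType}.
Implicit Types (t : R) (z w : R[i]) (f g : R -> R[i]).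

Definition is_cderive f t z :=
  is_derive t 1 (@Re R \o f) (Re z) /\ is_derive t 1 (@Im R \o f) (Im z).

Lemma is_cderiveM f g t z w : is_cderive f t z -> is_cderive g t w ->
  is_cderive (fun u => f u * g u) t (z * g t + f t * w).
Proof.
move=> [fr fi] [gr gi]; split.
  rewrite (_ : _ \o _ = fun u => (@Re R \o f) u * (@Re R \o g) u -
      (@Im R \o f) u * (@Im R \o g) u); last by apply/funext => u; rewrite /= ReM.
  apply: is_derive_eq; rewrite /GRing.scale/= ReD !ReM; ring.
rewrite (_ : _ \o _ = fun u => (@Re R \o f) u * (@Im R \o g) u +
    (@Im R \o f) u * (@Re R \o g) u); last by apply/funext => u; rewrite /= ImM.
apply: is_derive_eq; rewrite /GRing.scale/= ImD !ImM; ring.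
Qed.

Lemma is_cderiveD f g t z w : is_cderive f t z -> is_cderive g t w ->
  is_cderive (fun u => f u + g u) t (z + w).
Proof.
move=> [fr fi] [gr gi]; split.
  rewrite (_ : _ \o _ = fun u => (@Re R \o f) u + (@Re R \o g) u).
    by apply: is_derive_eq; rewrite ReD.
  by apply/funext => u; rewrite /= ReD.
rewrite (_ : _ \o _ = fun u => (@Im R \o f) u + (@Im R \o g) u).
  by apply: is_derive_eq; rewrite ImD.
by apply/funext => u; rewrite /= ImD.
Qed.

Lemma is_cderive_cst z t : is_cderive (fun=> z) t 0.
Proof. by split; exact: is_derive_cst. Qed.

(** Functions of z are differentiated only along the ray u z, in the real parameter u, so
    one-variable real calculus suffices. *)
Lemma is_cderiveZ z t : is_cderive (fun u => u%:C * z) t z.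
Proof.
split.
  rewrite (_ : _ \o _ = fun u => u * Re z).
    by apply: is_derive_eq; rewrite /GRing.scale/= mulr0 add0r mulr1.
  by apply/funext => u; rewrite /= ReM/= mul0r subr0.
rewrite (_ : _ \o _ = fun u => u * Im z).
  by apply: is_derive_eq; rewrite /GRing.scale/= mulr0 add0r mulr1.
by apply/funext => u; rewrite /= ImM/= mul0r addr0.
Qed.

Lemma is_cderiveX z t n :
  is_cderive (fun u => (u%:C * z) ^+ n.+1) t (z * n.+1%:R * (t%:C * z) ^+ n).
Proof.
elim: n => [|n IH].
  rewrite expr0 !mulr1; exact: is_cderiveZ.
have := is_cderiveM (is_cderiveZ z t) IH.
congr is_cderive.
rewrite -[n.+2%:R]natr1 exprS; ring.
Qed.

Lemma is_cderive_cexp z t :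
  is_cderive (fun u => cexp (u%:C * z)) t (z * cexp (t%:C * z)).
Proof.
have eR u : Re (u%:C * z) = u * Re z by rewrite ReM/= mul0r subr0.
have eI u : Im (u%:C * z) = u * Im z by rewrite ImM/= mul0r addr0.
have dM a : is_derive t 1 (fun u => u * a) a.
  by apply: is_derive_eq; rewrite /GRing.scale/= mulr0 add0r mulr1.
have de : is_derive t 1 (fun u => expR (u * Re z)) (expR (t * Re z) * Re z).
  exact: (@is_derive1_comp _ expR (fun u => u * Re z)).
have dc : is_derive t 1 (fun u => cos (u * Im z)) (- sin (t * Im z) * Im z).
  exact: (@is_derive1_comp _ cos (fun u => u * Im z)).
have ds : is_derive t 1 (fun u => sin (u * Im z)) (cos (t * Im z) * Im z).
  exact: (@is_derive1_comp _ sin (fun u => u * Im z)).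
split.
  rewrite (_ : _ \o _ = fun u => expR (u * Re z) * cos (u * Im z)); last first.
    by apply/funext => u; rewrite /= /cexp eR eI mul0r subr0.
  apply: is_derive_eq.
  rewrite /GRing.scale/= /cexp eR eI !(ReM, ImM)/=; ring.
rewrite (_ : _ \o _ = fun u => expR (u * Re z) * sin (u * Im z)); last first.
  by apply/funext => u; rewrite /= /cexp eR eI mul0r addr0.
apply: is_derive_eq.
rewrite /GRing.scale/= /cexp eR eI !(ReM, ImM)/=; ring.
Qed.

(** Allows every length, so that induction can add one term at a time; [eM] has only odd lengths
    once M >= 1. *)
Definition pexp n z : R[i] := \sum_(k < n) z ^+ k / k`!%:R.

Lemma is_cderive_pexp n z t :
  is_cderive (fun u => pexp n.+1 (u%:C * z)) t (z * pexp n (t%:C * z)).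
Proof.
elim: n => [|n IH].
  rewrite /pexp big_ord0 mulr0 (_ : (fun u => _) = cst 1).
    exact: is_cderive_cst.
  by apply/funext => u; rewrite big_ord1 expr0 fact0 divr1.
rewrite (_ : (fun u => _) = fun u => pexp n.+1 (u%:C * z) +
    (u%:C * z) ^+ n.+1 * (n.+1`!%:R)^-1); last first.
  by apply/funext => u; rewrite {1}/pexp big_ord_recr.
have := is_cderiveD IH (is_cderiveM (is_cderiveX z t n)
  (is_cderive_cst (n.+1`!%:R)^-1 t)).
congr is_cderive.
rewrite mulr0 addr0 /pexp big_ord_recr/= -/(pexp _ _) mulrDr; congr (_ + _).
rewrite factS natrM; field.
by rewrite nat1r !pnatr_eq0 -lt0n fact_gt0.
Qed.

Lemma norm_cexp z : `|cexp z| = (expR (Re z))%:C.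
Proof.
rewrite /cexp normrM normr_real_complex (ger0_norm (expR_ge0 _)).
by rewrite normc_def/= cos2Dsin2 sqrtr1 mulr1.
Qed.

Lemma cexp0 : cexp 0 = 1 :> R[i].
Proof. by rewrite /cexp /= expR0 cos0 sin0 mul1r. Qed.

Lemma pexp0 n : pexp n.+1 0 = 1.
Proof.
rewrite /pexp big_ord_recl expr0 fact0 divr1 big1 ?addr0// => i _.
by rewrite expr0n/= mul0r.
Qed.

Lemma is_cderive_continuous f t z : is_cderive f t z ->
  {for t, continuous (@Re R \o f)} /\ {for t, continuous (@Im R \o f)}.
Proof.
by move=> [[dr _] [di _]]; split;
  apply/differentiable_continuous/derivable1_diffP.
Qed.

(** The mean value theorem holds for the real and imaginary parts separately, at points c and d that
    may differ; adding the two bounds costs the factor 2. *)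
Lemma norm_le_MVT01 f f' (C : R) : (forall t, is_cderive f t (f' t)) ->
  (forall t, 0 < t < 1 -> `|f' t| <= C%:C) -> `|f 1 - f 0| <= (C *+ 2)%:C.
Proof.
move=> df fC.
have [c c01] : exists2 c, c \in `]0, 1[%R &
    Re (f 1) - Re (f 0) = Re (f' c) * (1 - 0).
  apply: (@MVT _ (@Re R \o f) (@Re R \o f')) => //.
    by move=> t _; have [] := df t.
  by apply: continuous_subspaceT => t; have [] := is_cderive_continuous (df t).
rewrite subr0 mulr1 => eR.
have [d d01] : exists2 c, c \in `]0, 1[%R &
    Im (f 1) - Im (f 0) = Im (f' c) * (1 - 0).
  apply: (@MVT _ (@Im R \o f) (@Im R \o f')) => //.
    by move=> t _; have [] := df t.
  by apply: continuous_subspaceT => t; have [] := is_cderive_continuous (df t).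
rewrite subr0 mulr1 => eI; rewrite !in_itv/= in c01 d01.
rewrite (le_trans (normc_le_ReIm _))// lecR ReD ReN ImD ImN eR eI mulr2n.
by rewrite lerD//; [apply: normRe_le|apply: normIm_le]; apply: fC.
Qed.

(* With p_n the n-term partial sum of the exponential series, the derivative of
   e^(-tz) p_(n+1)(tz) in t telescopes to - z e^(-tz) (tz)^n / n!. *)
Lemma cexpN_pexp_dist n z : `|cexp (- z) * pexp n.+1 z - 1| <=
  ((expR `|Re z| * (Re `|z| * exp_coeff (Re `|z|) n)) *+ 2)%:C.
Proof.
pose f t := cexp (t%:C * - z) * pexp n.+1 (t%:C * z).
have df t : is_cderive f t
    (- z * cexp (t%:C * - z) * ((t%:C * z) ^+ n / n`!%:R)).
  have := is_cderiveM (is_cderive_cexp (- z) t) (is_cderive_pexp n z t).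
  congr is_cderive; rewrite /pexp big_ord_recr/= -/(pexp n _).
  by move: (pexp _ _) => p; ring.
have := norm_le_MVT01 df.
rewrite /f mul1r mul1r !mul0r cexp0 pexp0 mul1r; apply.
move=> t /andP[t0 t1].
have nz : `|z| = (Re `|z|)%:C by rewrite RRe_real// normr_real.
have r0 : 0 <= Re `|z| by rewrite -ler0c -nz.
move: (Re `|z|) nz r0 => r nz r0.
rewrite normrM [X in X * _]normrM normrN norm_cexp normrM normfV normr_nat.
rewrite normrX normrM normr_real_complex (ger0_norm (ltW t0)) nz.
rewrite (_ : _ * _ = (r * expR (Re (t%:C * - z)) *
    ((t * r) ^+ n / n`!%:R))%:C); last first.
  by rewrite !rmorphM/= fmorphV rmorphXn rmorph_nat rmorphM.
rewrite lecR [leRHS]mulrCA [leRHS]mulrA.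
(* Since 0 < t < 1, the modulus e^(-t Re z) of the exponential is at most e^|Re z|, and (t r)^n is
   at most r^n. *)
apply: ler_pM.
- by rewrite mulr_ge0 ?expR_ge0.
- by rewrite divr_ge0// exprn_ge0// mulr_ge0// ltW.
- rewrite ler_wpM2l// ler_expR ReM/= mul0r subr0 ReN mulrN -mulNr.
  rewrite (le_trans (ler_norm _))// normrM normrN (ger0_norm (ltW t0)).
  by rewrite ler_piMl// ltW.
- rewrite /exp_coeff/= ler_wpM2r ?invr_ge0//.
  by rewrite lerXn2r ?nnegrE ?mulr_ge0 ?(ltW t0)// ler_piMl// ltW.
Qed.

Lemma cvg_cexpN_pexp z : cvg_ReIm (fun n => cexp (- z) * pexp n.+1 z) 1.
Proof.
apply: cvg_ReIm_dominated.
  by apply: nearW => n; exact: cexpN_pexp_dist.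
rewrite -(mul0rn _ 2) -(mulr0 (expR `|Re z|)) -(mulr0 (Re `|z|)).
apply: cvgMn; apply: cvgM; first exact: cvg_cst.
by apply: cvgM; [exact: cvg_cst|exact: cvg_exp_coeff].
Qed.

Lemma cvg_cexpN_eM z : cvg_ReIm (fun M => cexp (- z) * eM M z) 1.
Proof.
have [hr hi] := cvg_cexpN_pexp z.
pose v n := cexp (- z) * pexp n.+1 z.
apply: cvg_ReIm_shiftS.
(* [eM M.+1] has 2(M+1) - 1 = 2M + 1 terms, so the shifted sequence is the even-indexed subsequence
   of [v]. *)
rewrite (_ : (fun M => _) = fun M => v (2 * M)%N); last first.
  by apply/funext => M; rewrite /v /pexp /eM mulnS addSn subSS subn0 add1n.
have d_cvg : (2 * M)%N @[M --> \oo] --> \oo by exact: cvg_mulnl.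
by split; [exact: (cvg_comp _ _ d_cvg hr)|exact: (cvg_comp _ _ d_cvg hi)].
Qed.

Lemma cvg_expRN_eM (a : R) : expR (- a) * eM M a @[M --> \oo] --> (1 : R).
Proof.
have [h _] := cvg_cexpN_eM a%:C.
(* The real statement is the real part of the complex one at [a%:C]. *)
rewrite (_ : (fun M => _) =
    @Re R \o (fun M => cexp (- a%:C) * eM M a%:C)) //.
apply/funext => M; rewrite /= /cexp /eM ReM /= oppr0 cos0 sin0.
have -> : \sum_(k < 2 * M - 1) a%:C ^+ k / k`!%:R =
    (\sum_(k < 2 * M - 1) a ^+ k / k`!%:R)%:C.
  rewrite rmorph_sum/=; apply: eq_bigr => k _.
  by rewrite rmorphM/= fmorphV rmorphXn rmorph_nat.
by rewrite /= !(mulr0, mul0r, subr0, addr0, mulr1).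
Qed.

End ComplexExp.

(** * Vanishing of the remainder r_M *)

Section LowerGamma.
Context {R : realType}.
Implicit Types (x : R) (z : R[i]).
Local Notation mu := (@lebesgue_measure R).

(** Rounds half-integer exponents up to natural ones. It serves both the integrand of the incomplete
    gamma function and the power of 2 in r_M. *)
Lemma powRD_half_le (a b : R) n : 0 <= a -> a <= b -> 1 <= b ->
  a `^ (n%:R + 2^-1) <= b ^+ n.+1.
Proof.
move=> a0 ab b1; have b0 : 0 <= b by exact: le_trans ab.
apply: (@le_trans _ _ (b `^ (n%:R + 2^-1))).
  by apply: ge0_ler_powR; rewrite ?nnegrE// addr_ge0.
rewrite -powR_mulrn// ler_powR// -[n.+1%:R]natr1 lerD2l.
by rewrite invf_le1// ler1n.
Qed.

Lemma lower_gamma_ge0 (a y : R) : 0 <= lower_gamma a y.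
Proof.
by apply: Rintegral_ge0 => t _; rewrite mulr_ge0 ?powR_ge0 ?expR_ge0.
Qed.

(** The integrand's exponent is n + 1/2, so on [0, y] it stays below (1 + y)^(n+1), using e^(-t) <=
    1; the base 1 + y dominates t and is at least 1. *)
Lemma lower_gamma_le n (y : R) : 0 <= y ->
  lower_gamma (n.+2%:R - 1 / 2) y <= (1 + y) ^+ n.+1 * y.
Proof.
move=> y0.
have e : n.+2%:R - 1 / 2 - 1 = n%:R + 2^-1 :> R.
  by rewrite -addn2 natrD; lra.
have le : (\int[mu]_(t in `[0%R, y])
    (t `^ (n.+2%:R - 1 / 2 - 1) * expR (- t))%:E <=
    ((1 + y) ^+ n.+1 * y)%:E)%E.
  have -> : (((1 + y) ^+ n.+1 * y)%:E =
      \int[mu]_(t in `[0%R, y]) ((1 + y) ^+ n.+1)%:E)%E.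
    rewrite integral_cst//= lebesgue_measure_itv/= lte_fin.
    case: ltP => [_|y0']; first by rewrite sube0 EFinM.
    by have -> : y = 0 by apply/eqP; rewrite eq_le y0 y0'; rewrite ?mule0 ?mulr0.
  apply: ge0_le_integral => //.
  - by move=> t _; rewrite lee_fin mulr_ge0 ?powR_ge0 ?expR_ge0.
  - apply/measurable_EFinP/measurable_funTS/measurable_funM.
      exact: measurable_powR.
    by apply: measurableT_comp.
  - move=> t /=; rewrite in_itv/= => /andP[t0 ty].
    rewrite lee_fin e -[leRHS]mulr1 ler_pM ?powR_ge0 ?expR_ge0//.
      by rewrite powRD_half_le// ?lerDl// (le_trans ty)// lerDr.
    by rewrite -expR0 ler_expR oppr_le0.
have i0 : (0 <= \int[mu]_(t in `[0%R, y])
    (t `^ (n.+2%:R - 1 / 2 - 1) * expR (- t))%:E)%E.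
  by apply: integral_ge0 => t _; rewrite lee_fin mulr_ge0 ?powR_ge0 ?expR_ge0.
rewrite -[leRHS]/(fine (_%:E)) /lower_gamma; apply: fine_le => //.
by rewrite ge0_fin_numE// (le_lt_trans le)// ltry.
Qed.

(* With y = x^2/2 and r = |z|, shifting M by 2 makes gamma(M - 1/2, y) an
   integral of a bounded function and gives
   |r_(n+2)| <= const * (2 (1 + y) r^2)^(n+1) / (n+1)!. *)
Lemma cvg_rM z x : cvg_ReIm (fun M => rM M z x) 0.
Proof.
(* [A] gathers the factors independent of M, and [k] the real factors depending on it. *)
pose A : R[i] := cexp (- z ^+ 2 / 2) / sqrt2pi%:C
  * (Num.sqrt (erfc (Num.sqrt 2 * `|Im z|)))%:C * (Num.sg x)%:C.
pose y := x ^+ 2 / 2.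
have y0 : 0 <= y by rewrite divr_ge0// sqr_ge0.
pose k (M : nat) : R := 2 `^ (M%:R - 3 / 2) / ((2 * M - 2)`!)%:R *
  lower_gamma (M%:R - 1 / 2) y.
rewrite (_ : (fun M => _) = fun M => A * ((k M)%:C * z ^+ (2 * M - 1))); last first.
  by apply/funext => M; rewrite /rM /A /k rmorphM/=; ring.
rewrite -(mulr0 A); apply: cvg_ReImM; first exact: cvg_ReIm_cst.
do 2 apply: cvg_ReIm_shiftS.
have nz : `|z| = (Re `|z|)%:C by rewrite RRe_real// normr_real.
have r0 : 0 <= Re `|z| by rewrite -ler0c -nz.
move: (Re `|z|) nz r0 => r nz r0.
(* The factors of [w] come from the power of 2, from the gamma bound, and from |z|^(2n+3) = r
   (r^2)^(n+1). *)
pose w := 2 * (1 + y) * r ^+ 2.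
apply: (@cvg_ReIm_dominated _ _ _ (fun n => y * r * exp_coeff w n.+1)); last first.
  rewrite -(mulr0 (y * r)); apply: cvgM; first exact: cvg_cst.
  by rewrite (cvg_shiftS (exp_coeff w)); exact: cvg_exp_coeff.
apply: nearW => n; rewrite subr0 normrM normrX nz -rmorphXn.
have k0 : 0 <= k n.+2.
  by rewrite mulr_ge0 ?lower_gamma_ge0// divr_ge0 ?powR_ge0.
rewrite normr_real_complex ger0_norm// -rmorphM/= lecR.
have e2 : (2 * n.+2 - 2 = n.+1.*2)%N by rewrite -mul2n mulnS addKn.
have e1 : (2 * n.+2 - 1 = n.+1.*2.+1)%N.
  by rewrite -mul2n [(2 * n.+2)%N]mulnS !addSn add0n subSS subn0.
have hf : (n.+1`! <= n.+1.*2`!)%N.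
  by apply: leq_fact; rewrite -addnn leq_addr.
have h2 : (2 : R) `^ (n.+2%:R - 3 / 2) <= 2 ^+ n.+1.
  have -> : n.+2%:R - 3 / 2 = n%:R + 2^-1 :> R by rewrite -addn2 natrD; lra.
  by apply: powRD_half_le; rewrite // ler1n.
rewrite e1 (@le_trans _ _ (2 ^+ n.+1 / n.+1`!%:R * ((1 + y) ^+ n.+1 * y) *
    r ^+ n.+1.*2.+1))//.
  rewrite ler_wpM2r ?exprn_ge0// ler_pM ?lower_gamma_ge0 ?lower_gamma_le//.
  rewrite e2 ler_pM ?powR_ge0 ?invr_ge0// lef_pV2 ?posrE ?ltr0n ?fact_gt0//.
  by rewrite ler_nat.
have -> : r ^+ n.+1.*2.+1 = r * (r ^+ 2) ^+ n.+1.
  by rewrite exprS -mul2n exprM.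
rewrite /exp_coeff/= /w; move: (r ^+ 2) (_^-1) => q d.
by rewrite !exprMn le_eqVlt; apply/orP; left; apply/eqP; ring.
Qed.

End LowerGamma.

(** * Entrywise limits of the kernel *)

Section KernelLimit.
Context {R : realType}.
Implicit Types (x : R) (z g : R[i]).

Definition is_kernel_lim g g' (L : 'M[R[i]]_2) :=
  forall i j, cvg_ReIm (fun M => Ktilde M g g' i j) (L i j).

Lemma is_kernel_lim_mx2 g g' (a b c d : R[i]) :
  cvg_ReIm (fun M => DS_ M g g') a -> cvg_ReIm (fun M => S_ M g g') b ->
  cvg_ReIm (fun M => - S_ M g' g) c ->
  cvg_ReIm (fun M => IS_ M g g' + Eps g g') d ->
  is_kernel_lim g g' (mx2 a b c d).
Proof.
move=> Da Sb Sc Id i j; rewrite /Ktilde /mx2 !mxE; under eq_fun do rewrite mxE.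
by case: (i == 0); case: (j == 0).
Qed.

Lemma mx2Z (r a b c d : R[i]) :
  r *: mx2 a b c d = mx2 (r * a) (r * b) (r * c) (r * d).
Proof.
by apply/matrixP => i j; rewrite !mxE; case: (i == 0); case: (j == 0).
Qed.

Lemma cvg_expN_eMl (c w : R[i]) :
  cvg_ReIm (fun M => c * cexp (- w) * eM M w) c.
Proof.
under eq_fun do rewrite -mulrA.
rewrite -[X in cvg_ReIm _ X]mulr1.
by apply: cvg_ReImM; [exact: cvg_ReIm_cst|exact: cvg_cexpN_eM].
Qed.

Lemma cvg_expRN_eMl (c a : R) :
  cvg_ReIm (fun M => (c * expR (- a) * eM M a)%:C) c%:C.
Proof.
apply: cvg_ReIm_real; under eq_fun do rewrite -mulrA.
have := cvgM (cvg_cst c) (cvg_expRN_eM a).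
by rewrite mulr1; exact.
Qed.

Lemma cvg_S_rr x x' : cvg_ReIm (fun M => S_rr M x x')
  (expR (- (x - x') ^+ 2 / 2) / sqrt2pi)%:C.
Proof.
rewrite -[X in cvg_ReIm _ X]addr0.
by apply: cvg_ReImD; [exact: cvg_expRN_eMl|exact: cvg_rM].
Qed.

Lemma cvg_S_cr z x : cvg_ReIm (fun M => S_cr M z x)
  (cexp (- (x%:C - z) ^+ 2 / 2) / sqrt2pi%:C * (E1 z)%:C).
Proof.
rewrite -[X in cvg_ReIm _ X]addr0.
by apply: cvg_ReImD; [exact: cvg_expN_eMl|exact: cvg_rM].
Qed.

Lemma cvg_IS_rc x z : cvg_ReIm (fun M => IS_rc M x z)
  (- ('i * cexp (- (x%:C - z^*) ^+ 2 / 2) / sqrt2pi%:C * (E1 z)%:C)).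
Proof.
rewrite -[X in cvg_ReIm _ X]subr0 -(mulr0 'i); apply: cvg_ReImD.
  by apply: cvg_ReImN; exact: cvg_expN_eMl.
apply: cvg_ReImN; apply: cvg_ReImM; first exact: cvg_ReIm_cst.
exact: cvg_rM.
Qed.

Lemma is_kernel_lim_rr x x' : is_kernel_lim x%:C x'%:C
  (mx2 (1 / Num.sqrt (2 * pi) * (x' - x) * expR (- (x - x') ^+ 2 / 2))%:C
       (1 / Num.sqrt (2 * pi) * expR (- (x - x') ^+ 2 / 2))%:C
       (- (1 / Num.sqrt (2 * pi) * expR (- (x - x') ^+ 2 / 2)))%:C
       (1 / 2 * Num.sg (x - x') * erfc (`|x - x'| / Num.sqrt 2))%:C).
Proof.
apply: is_kernel_lim_mx2; rewrite /DS_ /S_ /IS_ /Eps /= eqxx.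
- apply: cvg_ReIm_eq (cvg_expRN_eMl _ _) _.
  by rewrite mul1r; congr (_%:C); ring.
- by apply: cvg_ReIm_eq (cvg_S_rr _ _) _; rewrite mul1r mulrC.
- apply: cvg_ReIm_eq (cvg_ReImN (cvg_S_rr _ _)) _.
  by rewrite -rmorphN mul1r [in RHS]mulrC -(opprB x x') sqrrN.
- rewrite /IS_rr; under eq_fun do rewrite -rmorphD/=.
  by apply: cvg_ReIm_real; exact: cvg_IS_rr.
Qed.

Lemma is_kernel_lim_cc z z' : 0 < Im z -> 0 < Im z' -> is_kernel_lim z z'
  ((1 / Num.sqrt (2 * pi) * Num.sqrt (erfc (Num.sqrt 2 * Im z)
      * erfc (Num.sqrt 2 * Im z')))%:C *:
   mx2 ((z' - z) * cexp (- (z - z') ^+ 2 / 2))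
       ('i * (z'^* - z) * cexp (- (z - z'^*) ^+ 2 / 2))
       ('i * (z' - z^*) * cexp (- (z^* - z') ^+ 2 / 2))
       (- (z'^* - z^*) * cexp (- (z^* - z'^*) ^+ 2 / 2))).
Proof.
move=> z0 z'0; rewrite mx2Z mul1r -/sqrt2pi -/(E2 z z') rmorphM fmorphV/=.
apply: is_kernel_lim_mx2; rewrite /DS_ /S_ /IS_ /Eps !gt_eqF//=.
- by apply: cvg_ReIm_eq (cvg_expN_eMl _ _) _; move: (cexp _) => c; ring.
- by apply: cvg_ReIm_eq (cvg_expN_eMl _ _) _; move: (cexp _) => c; ring.
(* This entry is -S(z', z): the minus sign turns conj z - z' into z' - conj z, while the square and
   [E2] are symmetric. *)
- apply: cvg_ReIm_eq (cvg_ReImN (cvg_expN_eMl _ _)) _.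
  rewrite -(opprB z' z^*) sqrrN (_ : E2 z' z = E2 z z'); last by rewrite /E2 mulrC.
  by move: (cexp _) => c; ring.
- under eq_fun do rewrite addr0.
  apply: cvg_ReIm_eq (cvg_ReImN (cvg_expN_eMl _ _)) _.
  by move: (cexp _) => c; ring.
Qed.

Lemma is_kernel_lim_rc x z : 0 < Im z -> is_kernel_lim x%:C z
  ((1 / Num.sqrt (2 * pi) * Num.sqrt (erfc (Num.sqrt 2 * Im z)))%:C *:
   mx2 ((z - x%:C) * cexp (- (x%:C - z) ^+ 2 / 2))
       ('i * (z^* - x%:C) * cexp (- (x%:C - z^*) ^+ 2 / 2))
       (- cexp (- (x%:C - z) ^+ 2 / 2))
       (- 'i * cexp (- (x%:C - z^*) ^+ 2 / 2))).
Proof.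
move=> z0; rewrite mx2Z mul1r -/sqrt2pi -/(E1 z) rmorphM fmorphV/=.
apply: is_kernel_lim_mx2; rewrite /DS_ /S_ /IS_ /Eps /= eqxx !gt_eqF//=.
- by apply: cvg_ReIm_eq (cvg_expN_eMl _ _) _; move: (cexp _) => c; ring.
- by apply: cvg_ReIm_eq (cvg_expN_eMl _ _) _; move: (cexp _) => c; ring.
- apply: cvg_ReIm_eq (cvg_ReImN (cvg_S_cr _ _)) _.
  by move: (cexp _) => c; ring.
- under eq_fun do rewrite addr0.
  by apply: cvg_ReIm_eq (cvg_IS_rc _ _) _; move: (cexp _) => c; ring.
Qed.

(** Only existence is claimed for complex/real arguments; the entries of the limit are filled in by
    unification from the convergence lemmas. *)
Lemma is_kernel_lim_cr z x : 0 < Im z -> exists L, is_kernel_lim z x%:C L.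
Proof.
move=> z0; eexists; apply: is_kernel_lim_mx2;
  rewrite /DS_ /S_ /IS_ /Eps /= eqxx !gt_eqF//=.
- by apply: cvg_ReImN; exact: cvg_expN_eMl.
- exact: cvg_S_cr.
- by apply: cvg_ReImN; exact: cvg_expN_eMl.
- by apply: cvg_ReImD; [apply: cvg_ReImN; exact: cvg_IS_rc|exact: cvg_ReIm_cst].
Qed.

Lemma ex_kernel_lim g g' : 0 <= Im g -> 0 <= Im g' ->
  exists L, is_kernel_lim g g' L.
Proof.
have realE h : 0 = Im h -> h = (Re h)%:C by case: h => a b /= <-.
rewrite !le_eqVlt => /predU1P[/realE->|g0] /predU1P[/realE->|g'0].
- by eexists; exact: is_kernel_lim_rr.
- by eexists; exact: is_kernel_lim_rc.
- exact: is_kernel_lim_cr.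
- by eexists; exact: is_kernel_lim_cc.
Qed.

End KernelLimit.

Theorem corollary9 (R : realType) :
  exists K : R[i] -> R[i] -> 'M[R[i]]_2,
  [/\ forall g g' : R[i], 0 <= Im g -> 0 <= Im g' ->
        forall i j : 'I_2,
          (fun M : nat => Ktilde M g g' i j : R[i]^o) @ \oo
            --> (K g g' i j : R[i]^o),
      forall x x' : R,
        K x%:C x'%:C =
        mx2 (1 / Num.sqrt (2 * pi) * (x' - x)
               * expR (- (x - x') ^+ 2 / 2))%:C
            (1 / Num.sqrt (2 * pi) * expR (- (x - x') ^+ 2 / 2))%:C
            (- (1 / Num.sqrt (2 * pi) * expR (- (x - x') ^+ 2 / 2)))%:C
            (1 / 2 * Num.sg (x - x') * erfc (`|x - x'| / Num.sqrt 2))%:C,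
      forall z z' : R[i], 0 < Im z -> 0 < Im z' ->
        K z z' =
        (1 / Num.sqrt (2 * pi)
           * Num.sqrt (erfc (Num.sqrt 2 * Im z)
                       * erfc (Num.sqrt 2 * Im z')))%:C *:
        mx2 ((z' - z) * cexp (- (z - z') ^+ 2 / 2))
            ('i * (z'^* - z) * cexp (- (z - z'^*) ^+ 2 / 2))
            ('i * (z' - z^*) * cexp (- (z^* - z') ^+ 2 / 2))
            (- (z'^* - z^*) * cexp (- (z^* - z'^*) ^+ 2 / 2))
    & forall (x : R) (z : R[i]), 0 < Im z ->
        K x%:C z =
        (1 / Num.sqrt (2 * pi) * Num.sqrt (erfc (Num.sqrt 2 * Im z)))%:C *:
        mx2 ((z - x%:C) * cexp (- (x%:C - z) ^+ 2 / 2))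
            ('i * (z^* - x%:C) * cexp (- (x%:C - z^*) ^+ 2 / 2))
            (- cexp (- (x%:C - z) ^+ 2 / 2))
            (- 'i * cexp (- (x%:C - z^*) ^+ 2 / 2))].
Proof.
(* [lim] makes [K] total; wherever a limit has been found, uniqueness of limits ([KE]) identifies
   [K] with it. *)
pose K (g g' : R[i]) : 'M[R[i]]_2 :=
  \matrix_(i, j) (lim ((fun M => Ktilde M g g' i j : R[i]^o) @ \oo) : R[i]).
have KE g g' L : is_kernel_lim g g' L -> K g g' = L.
  move=> gL; apply/matrixP => i j; rewrite mxE.
  by apply: (@cvg_lim (R[i]^o)); [exact: norm_hausdorff|exact: cvg_ReImP].
exists K; split.
- move=> g g' g0 g'0 i j; have [L gL] := ex_kernel_lim g0 g'0.
  by rewrite (KE _ _ _ gL); exact: cvg_ReImP.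
- by move=> x x'; apply: KE; exact: is_kernel_lim_rr.
- by move=> z z' z0 z'0; apply: KE; exact: is_kernel_lim_cc.
- by move=> x z z0; apply: KE; exact: is_kernel_lim_rc.
Qed.
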